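(* Let $G=(V,E)$ be a graph on $n$ vertices with minimum degree at least $\epsilon n$, where $\epsilon>0$. Then there is a covering $E=E_1\cup\cdots\cup E_\ell$ of the edge set of $G$ (not necessarily disjoint) with $\ell=2\epsilon^{-2}\log_2 n$ such that for $1\le i\le \ell$ the diameter of $E_i$ is at most $3$.
   Context: The diameter of a connected graph is the maximum distance between two vertices ($\infty$ if disconnected). The diameter of an edge set $E'$ is the diameter of the graph with edge set $E'$ on the vertices covered by $E'$. *)

(* Defs.v *)
From HB Require Import structures.
From mathcomp Require Import all_boot all_order all_algebra.
From mathcomp Require Import classical_sets reals ereal exp.
Set Implicit Arguments.
Unset Strict Implicit.
Unset Printing Implicit Defensive.
Import Order.TTheory GRing.Theory Num.Theory.
Local Open Scope ring_scope.

(* A finite simple graph with vertex set [V] is given by its edge set [E], a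
   set of unordered pairs of distinct vertices. *)
Definition simple_graph (V : finType) (E : {set {set V}}) : Prop :=
  forall A : {set V}, A \in E -> #|A| = 2%N.

Definition adj (V : finType) (E : {set {set V}}) : rel V :=
  fun x y => [set x; y]%SET \in E.

Definition degree (V : finType) (E : {set {set V}}) (v : V) : nat :=
  #|[set u | adj E v u]%SET|.

(* In a simple graph every degree is smaller than [#|V|], so the default value
   of the minimum only matters when [V] is empty. *)
Definition min_degree (V : finType) (E : {set {set V}}) : nat :=
  \big[minn/#|V|]_(v : V) degree E v.

(* The least length of a walk from [x] to [y]; it is +oo when there is none,
   as the infimum of the empty set. *)
Definition dist (R : realType) (V : finType) (E : {set {set V}}) (x y : V) :
    \bar R :=
  ereal_inf [set ((size p)%:R)%:E |
              p in [set p : seq V | path (adj E) x p /\ last x p = y]]%classic.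

(* The graph with edge set [E] is taken on the vertices covered by [E] only.
   The empty edge set gets diameter 0. *)
Definition diameter (R : realType) (V : finType) (E : {set {set V}}) : \bar R :=
  \big[maxe/0%E]_(x in finset.cover E) \big[maxe/0%E]_(y in finset.cover E) dist R E x y.

Definition log2 (R : realType) (x : R) : R := ln x / ln 2.

(* Main.v *)
(* For vertices u and v let F(u, v) consist of the edges lying on walks
   u, x, y, v of length 3. Two such walks form a closed walk of length 6, so any
   two vertices covered by F(u, v) are at distance at most 3 in it. An edge xy
   lies in F(u, v) whenever u is a neighbour of x and v a neighbour of y, hence
   for a proportion p = eps^2 of the pairs (u, v). Choosing pairs greedily, the
   number of uncovered edges after l steps is at most (1 - p)^l |E|, and this is
   below 1 since 1 - p <= 2^-p, |E| <= n^2 / 2 and p (l + 1) > 2 log2 n. *)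
Require Import Defs.
From HB Require Import structures.
From mathcomp Require Import all_boot all_order all_algebra.
From mathcomp Require Import classical_sets reals ereal exp.
From mathcomp Require Import sequences ring lra.
Set Implicit Arguments.
Unset Strict Implicit.
Unset Printing Implicit Defensive.
Import Order.TTheory GRing.Theory Num.Theory.
Local Open Scope ring_scope.

Section GreedyCover.
Variables (R : realFieldType) (I T : finType) (C : I -> {set T}) (p : R).

(** Double counting of the pairs [(i, e)] with [e] in [E :&: C i]: there are at least
    [p * #|I| * #|E|] of them, but strictly fewer if every [i] fell short. *)
Lemma exists_ge_average (E : {set T}) :
  (0 < #|I|)%N ->
  (forall e, e \in E -> p * #|I|%:R <= #|[set i | e \in C i]|%:R) ->
  exists i, p * #|E|%:R <= #|E :&: C i|%:R.
Proof.
move=> I_gt0 Cp; apply/existsP; apply: contraTT isT => /existsPn small.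
have dbl : (\sum_i #|E :&: C i| = \sum_(e in E) #|[set i | e \in C i]|)%N.
  under eq_bigr => i _ do
    rewrite -sum1_card (eq_bigl _ _ (fun e => finset.in_setI e E (C i))) big_mkcondr.
  rewrite exchange_big; apply: eq_bigr => e _.
  by rewrite -big_mkcond sum1dep_card.
have lb : \sum_(e in E) p * #|I|%:R <=
          \sum_(e in E) (#|[set i | e \in C i]|%:R : R).
  by apply: ler_sum => e /Cp.
(* Summing strict bounds gives a strict bound only over a nonempty index type. *)
have ub : \sum_i (#|E :&: C i|%:R : R) < \sum_(i : I) p * #|E|%:R.
  apply: ltr_sum => [|i _]; last by rewrite ltNge small.
  by have [i _] := card_gt0P I_gt0; apply/hasP; exists i; rewrite ?mem_index_enum.
move: lb ub; rewrite -!natr_sum dbl !sumr_const => lb ub.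
have := le_lt_trans lb ub.
by rewrite -[_ *+ #|E|]mulr_natr -[X in _ < X]mulr_natr mulrAC ltxx.
Qed.

(** The covering hypothesis passes to the uncovered part [U] of [E], so averaging over [U] gives an
    index that removes a proportion [p] of it. *)
Lemma greedy_cover (E : {set T}) (l : nat) :
  (0 < #|I|)%N -> p <= 1 ->
  (forall e, e \in E -> p * #|I|%:R <= #|[set i | e \in C i]|%:R) ->
  exists s : l.-tuple I,
    #|E :\: \bigcup_(i < l) C (tnth s i)|%:R <= (1 - p) ^+ l * #|E|%:R.
Proof.
move=> I_gt0 p_le1 Cp; elim: l => [|l [s IHs]].
  by exists [tuple]; rewrite big_ord0 finset.setD0 expr0 mul1r.
set U := E :\: _ in IHs.
have [|i hi] := @exists_ge_average U I_gt0.
  by move=> e /finset.setDP[/Cp].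
exists [tuple of i :: s]; rewrite big_ord_recl tnth0.
under eq_bigr do rewrite tnthS.
rewrite finset.setUC -finset.setDDl -/U exprS -mulrA.
apply: le_trans (ler_wpM2l _ IHs); last by rewrite subr_ge0.
have := congr1 (fun k => k%:R : R) (cardsID (C i) U); rewrite /= natrD => cU.
lra.
Qed.

End GreedyCover.

Section ThreeWalks.
Variables (V : finType) (E : {set {set V}}).

Lemma adj_sym : symmetric (adj E).
Proof. by move=> x y; rewrite /adj finset.setUC. Qed.

Lemma min_degree_le v : (min_degree E <= degree E v)%N.
Proof.
rewrite /min_degree; elim: (index_enum V) (mem_index_enum v) => // w r IHr.
rewrite inE big_cons => /predU1P[<-|/IHr]; first exact: geq_minl.
exact: leq_trans (geq_minr _ _).
Qed.

Lemma card_simple_graph : simple_graph E -> (#|E| <= 'C(#|V|, 2))%N.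
Proof.
move=> sE; rewrite -(card_draws V 2); apply: subset_leq_card.
by apply/fintype.subsetP => A /sE; rewrite inE => /eqP.
Qed.

(** These are walks, not paths: vertices may repeat and [u = v] is allowed, so that every choice of
    a neighbour of [x] and a neighbour of [y] counts. *)
Definition walk3_edges (uv : V * V) : {set {set V}} :=
  [set e | [exists x, exists y,
    [&& adj E uv.1 x, adj E x y, adj E y uv.2 &
        e \in [:: [set uv.1; x]; [set x; y]; [set y; uv.2]]]]]%SET.

Lemma walk3_edges_sub uv : walk3_edges uv \subset E.
Proof.
apply/fintype.subsetP => e; rewrite inE => /existsP[x /existsP[y /and4P[ux xy yv]]].
by rewrite !inE => /or3P[] /eqP->.
Qed.

(** Distances will be measured in [F] rather than in [E], so the walk itself has to survive in
    [F]. *)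
Lemma adj_walk3_edges u v x y : adj E u x -> adj E x y -> adj E y v ->
  let F := walk3_edges (u, v) in [/\ adj F u x, adj F x y & adj F y v].
Proof.
move=> ux xy yv F; split; rewrite /adj inE; apply/existsP; exists x;
  apply/existsP; exists y; by rewrite ux xy yv !inE eqxx ?orbT.
Qed.

Lemma cover_walk3_edges u v w : w \in finset.cover (walk3_edges (u, v)) ->
  exists x y, [/\ adj E u x, adj E x y, adj E y v & w \in [:: u; x; y; v]].
Proof.
case/bigcupP=> e; rewrite inE => /existsP[x /existsP[y /and4P[ux xy yv]]] /= he we.
exists x, y; split=> //.
by move: he we; rewrite !inE => /or3P[] /eqP->; rewrite !inE => /orP[] ->; rewrite ?orbT.
Qed.

Lemma mem_walk3_edges u v x y : adj E u x -> adj E x y -> adj E y v ->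
  [set x; y]%SET \in walk3_edges (u, v).
Proof. by move=> ux xy yv; have [] := adj_walk3_edges ux xy yv. Qed.

Lemma card_walk3_edges x y : [set x; y]%SET \in E ->
  (min_degree E ^ 2 <= #|[set uv | [set x; y]%SET \in walk3_edges uv]|)%N.
Proof.
move=> xy; apply: leq_trans (_ : degree E x * degree E y <= _)%N.
  by rewrite expnS expn1 leq_mul ?min_degree_le.
rewrite /degree -cardsX; apply: subset_leq_card; apply/fintype.subsetP => -[u v].
rewrite !inE /= => /andP[xu yv].
have := mem_walk3_edges (u := u) (v := v) (x := x) (y := y).
by rewrite inE; apply=> //; rewrite adj_sym.
Qed.

End ThreeWalks.

Lemma dist_le_size (R : realType) (V : finType) (E : {set {set V}}) x p :
  path (adj E) x p -> (dist R E x (last x p) <= ((size p)%:R)%:E)%E.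
Proof. by move=> xp; apply: ereal_inf_lbound; exists p. Qed.

Lemma diameter_walk3_edges (R : realType) (V : finType) (E : {set {set V}}) uv :
  (diameter R (walk3_edges E uv) <= 3%:E)%E.
Proof.
case: uv => u v; set F := walk3_edges E (u, v).
apply: bigmax_le => // w hw; apply: bigmax_le => // w' hw'.
have [x [y [/adj_walk3_edges h /h{}h /h{h}[ux xy yv] wP]]] := cover_walk3_edges hw.
have [x' [y' [/adj_walk3_edges h /h{}h /h{h}[ux' xy' yv'] wP']]] :=
  cover_walk3_edges hw'.
have walk p : path (adj F) w p -> last w p = w' -> (size p <= 3)%N ->
    (dist R F w w' <= 3%:E)%E.
  move=> wp <- p3; apply: le_trans (dist_le_size _ wp) _.
  by rewrite lee_fin ler_nat.
have [xu yx vy] : [/\ adj F x u, adj F y x & adj F v y] by split; rewrite adj_sym.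
have [xu' yx' vy'] : [/\ adj F x' u, adj F y' x' & adj F v y'].
  by split; rewrite adj_sym.
move: wP wP'; rewrite !inE.
(* Each of the sixteen positions of [w] and [w'] is settled by a shortest arc of the closed walk
   [u, x, y, v, y', x', u]. *)
case/or4P=> /eqP ew /or4P[] /eqP ew'; rewrite {}ew {}ew' in walk *.
- by apply: (walk [::]).
- by apply: (walk [:: x']); rewrite //= ?ux'.
- by apply: (walk [:: x'; y']); rewrite //= ?ux' ?xy'.
- by apply: (walk [:: x; y; v]); rewrite //= ?ux ?xy ?yv.
- by apply: (walk [:: u]); rewrite //= ?xu.
- by apply: (walk [:: u; x']); rewrite //= ?xu ?ux'.
- by apply: (walk [:: u; x'; y']); rewrite //= ?xu ?ux' ?xy'.
- by apply: (walk [:: y; v]); rewrite //= ?xy ?yv.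
- by apply: (walk [:: x; u]); rewrite //= ?yx ?xu.
- by apply: (walk [:: x; u; x']); rewrite //= ?yx ?xu ?ux'.
- by apply: (walk [:: v; y']); rewrite //= ?yv ?vy'.
- by apply: (walk [:: v]); rewrite //= ?yv.
- by apply: (walk [:: y; x; u]); rewrite //= ?vy ?yx ?xu.
- by apply: (walk [:: y'; x']); rewrite //= ?vy' ?yx'.
- by apply: (walk [:: y']); rewrite //= ?vy'.
- by apply: (walk [::]).
Qed.

(** Rounding the number of steps down loses a factor of at most 2, which the bound [n ^ 2 / 2] on
    the number of edges makes up for. *)
Lemma greedy_steps (R : realType) (n : nat) (p : R) :
  (0 < n)%N -> 0 < p -> p <= 1 ->
  (1 - p) ^+ Num.truncn (2 * p^-1 * log2 (n%:R : R)) * ('C(n, 2))%:R < 1.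
Proof.
move=> n_gt0 p_gt0 p_le1; set l := Num.truncn _.
have ln2_gt0 : 0 < ln 2 :> R by apply: ln_gt0; lra.
have ln2_le1 : ln 2 <= 1 :> R.
  by have := @le_ln1Dx R 1; rewrite (_ : 1 + 1 = 2) //; apply; lra.
have nR_gt0 : 0 < n%:R :> R by rewrite ltr0n.
(* Truncation bounds [l + 1] from below; the missing step costs [p * ln 2]. *)
have hl : 2 * ln n%:R - p * ln 2 < l%:R * (p * ln 2) :> R.
  have := truncnS_gt (2 * p^-1 * log2 (n%:R : R)); rewrite -/l -natr1.
  rewrite -(ltr_pM2r (mulr_gt0 p_gt0 ln2_gt0)) /log2.
  rewrite (_ : _ * (p * ln 2) = 2 * ln n%:R); last by field; rewrite !gt_eqF.
  by lra.
(* Here [1 - p <= 1 - p * ln 2 <= expR (- (p * ln 2))], using [ln 2 <= 1]. *)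
have pl : (1 - p) ^+ l <= expR (- (l%:R * (p * ln 2))).
  rewrite -mulrN expRM_natl; apply: lerXn2r; rewrite ?nnegrE ?expR_ge0 ?subr_ge0 //.
  apply: le_trans (expR_ge1Dx _); rewrite lerD2l lerN2.
  by rewrite ger_pMr.
have pl2 : (1 - p) ^+ l < 2 / n%:R ^+ 2.
  apply: le_lt_trans pl _.
  rewrite -[X in _ < X]lnK ?posrE ?divr_gt0 ?exprn_gt0 // ltr_expR.
  rewrite ln_div ?posrE ?exprn_gt0 // lnXn // -mulr_natl.
  have : p * ln 2 <= ln 2 by rewrite ger_pMl.
  lra.
have C_le : ('C(n, 2))%:R <= n%:R ^+ 2 / 2 :> R.
  rewrite ler_pdivlMr // -natrX -natrM ler_nat muln2 bin2 halfK.
  by rewrite (leq_trans (leq_subr _ _)) // expnS expn1 leq_mul // leq_pred.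
(* The strict bound [pl2] stays strict only after multiplication by a positive number; for [n = 1]
   the product is 0. *)
have [C0|C_gt0] := posnP 'C(n, 2); first by rewrite C0 mulr0.
rewrite [ltRHS](_ : 1 = (2 / n%:R ^+ 2) * (n%:R ^+ 2 / 2)); last first.
  by field; rewrite gt_eqF.
apply: lt_le_trans (_ : 2 / n%:R ^+ 2 * ('C(n, 2))%:R <= _).
  by rewrite ltr_pM2r // ltr0n.
by rewrite ler_wpM2l // divr_ge0 ?exprn_ge0 // ler0n.
Qed.

Theorem theorem3p1 (R : realType) (V : finType) (E : {set {set V}})
    (n : nat) (eps : R) :
  simple_graph E ->
  #|V| = n ->
  0 < eps ->
  eps * n%:R <= (min_degree E)%:R ->
  exists F : 'I_(Num.truncn (2 * eps ^- 2 * log2 (n%:R : R))) -> {set {set V}},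
    E = (\bigcup_i F i)%SET /\
    forall i, (diameter R (F i) <= 3%:E)%E.
Proof.
move=> sE Vn eps_gt0 eps_deg; set l := Num.truncn _.
have pair_of e : e \in E -> exists x y, e = [set x; y]%SET.
  by move=> /sE /eqP/cards2P[x [y [_ ->]]]; exists x, y.
(* Without vertices there are no pairs to choose from, but also no edges: empty sets do, with
   diameter 0 by default. *)
have [n0|n_gt0] := posnP n.
  exists (fun=> finset.set0); split=> [|i]; last first.
    by rewrite /diameter /finset.cover !big_set0 ?big1 ?lee_fin.
  rewrite big1 //; apply/finset.setP => e; rewrite inE; apply/negbTE/negP.
  move=> /pair_of[x _]; move: (card0_eq (etrans Vn n0) x).
  by rewrite inE.
have nR_gt0 : 0 < n%:R :> R by rewrite ltr0n.
have [v0 _] : exists v : V, v \in V by apply/card_gt0P; rewrite Vn.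
have eps_le1 : eps <= 1.
  rewrite -(ler_pM2r nR_gt0) mul1r (le_trans eps_deg) // ler_nat -Vn.
  exact: leq_trans (min_degree_le E v0) (max_card _).
have p_gt0 : 0 < eps ^+ 2 by rewrite exprn_gt0.
have p_le1 : eps ^+ 2 <= 1 by rewrite exprn_ile1 // ltW.
have IVn : #|{: V * V}| = (n ^ 2)%N by rewrite card_prod Vn.
(* The indices are the [n ^ 2] ordered pairs of vertices, and [eps ^+ 2] times their number is at
   most the squared minimum degree. *)
have [||s hs] := @greedy_cover R _ _ (walk3_edges E) (eps ^+ 2) E l _ p_le1.
- by rewrite IVn expn_gt0 n_gt0.
- move=> e eE; have [x [y exy]] := pair_of e eE; rewrite exy in eE *.
  apply: le_trans (_ : (min_degree E ^ 2)%:R <= _); last first.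
    by rewrite ler_nat card_walk3_edges.
  rewrite IVn !natrX -exprMn lerXn2r ?nnegrE ?ler0n //.
  by rewrite mulr_ge0 ?ler0n // ltW.
exists (fun i => walk3_edges E (tnth s i)); split=> [|i]; last first.
  exact: diameter_walk3_edges.
apply/eqP; rewrite finset.eqEsubset; apply/andP; split; last first.
  by apply/bigcupsP => i _; apply: walk3_edges_sub.
(* The number of uncovered edges is a natural number, so it vanishes once it is below 1. *)
rewrite -finset.setD_eq0 -cards_eq0 -leqn0 -ltnS -(ltr_nat R).
apply: le_lt_trans hs _.
apply: le_lt_trans (greedy_steps n_gt0 p_gt0 p_le1).
rewrite ler_wpM2l ?exprn_ge0 ?subr_ge0 // ler_nat -Vn.
exact: card_simple_graph.
Qed.
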